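(* Let $(G,H,\alpha,\tau)$ be a Lie crossed module, $\pi:P\to M$ a principal $G$-bundle, and $\bar A$, $A$ connection forms on it. Let $B_0$ be an $L(G)$-valued $2$-form, $B_1$ an $L(H)$-valued $2$-form, $C_0^L,C_0^R$ $L(G)$-valued $1$-forms and $C_1^L,C_1^R$ $L(H)$-valued $1$-forms on $P$, all equivariant and horizontal (as defined in the context). On $\mathcal{P}^{\rm dec}_{\bar A}P=\mathcal{P}_{\bar A}P\times H$ define the $L(H\rtimes_\alpha G)$-valued $1$-form $$\Omega_{(\bar\gamma,h)}(\bar v+X)=\mathrm{Ad}(h^{-1})\Big[\omega_{\bar\gamma}(\bar v)+C_1^R|_{\bar\gamma(t_1)}(\bar v(t_1))-C_1^L|_{\bar\gamma(t_0)}(\bar v(t_0))+\int_{t_0}^{t_1}B_1|_{\bar\gamma(t)}\big(\bar v(t),\bar\gamma'(t)\big)dt+Xh^{-1}\Big],$$ where $$\omega_{\bar\gamma}(\bar v)=A_{\bar\gamma(t_0)}(\bar v(t_0))+C_0^R|_{\bar\gamma(t_1)}(\bar v(t_1))-C_0^L|_{\bar\gamma(t_0)}(\bar v(t_0))+\int_{t_0}^{t_1}B_0|_{\bar\gamma(t)}\big(\bar v(t),\bar\gamma'(t)\big)dt,$$ for $\bar\gamma\in\mathcal{P}_{\bar A}P$ with domain $[t_0,t_1]$, $h\in H$, $\bar v\in T_{\bar\gamma}\mathcal{P}_{\bar A}P$, $X\in T_hH$. Then $\Omega$ is a connection on $\mathcal{P}^{\rm dec}_{\bar A}P\to\mathcal{P}M$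 in the following sense. (i) It is equivariant under the right action of $H\rtimes_\alpha G$: $$\Omega_{(\bar\gamma,h)h_1g_1}\,\mathcal{R}_{(h_1,g_1)*}(\bar v,X)=\mathrm{Ad}\big((h_1g_1)^{-1}\big)\,\Omega_{(\bar\gamma,h)}(\bar v,X)$$ for all $h,h_1\in H$, $g_1\in G$, $\bar\gamma\in\mathcal{P}_{\bar A}P$, $\bar v\in T_{\bar\gamma}\mathcal{P}_{\bar A}P$, $X\in T_hH$. (ii) For all $(Y_1,Z_1)\in L(H)\oplus L(G)$ and all $(\bar\gamma,h)\in\mathcal{P}^{\rm dec}_{\bar A}P$, $$\Omega_{(\bar\gamma,h)}\,r_{(\bar\gamma,h)}(Y_1+Z_1)=Y_1+Z_1.$$
   Context: A Lie crossed module $(G,H,\alpha,\tau)$ consists of Lie groups $G,H$, a smooth homomorphism $\tau:H\to G$ and a homomorphism $\alpha:G\to\mathrm{Aut}(H)$ with $(g,h)\mapsto\alpha(g)(h)$ smooth, such that $\tau(\alpha(g)(h))=g\tau(h)g^{-1}$ and $\alpha(\tau(h))(h')=hh'h^{-1}$. The semidirect product $H\rtimes_\alpha G$ has product $(h_1,g_1)(h_2,g_2)=(h_1\alpha(g_1)(h_2),g_1g_2)$; $G$ and $H$ are identified with subgroups, $hg=(h,g)$, so $\alpha(g)(h)=ghg^{-1}$. The Lie algebra $L(H\rtimes_\alpha G)$ is $L(H)\oplus L(G)$ as a vector space, and $\mathrm{Ad}$ denotes the adjoint action of $H\rtimes_\alpha G$ on it; $\mathrm{Ad}(g)$ for $g\in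 G$ restricts to $d\alpha(g)|_e$ on $L(H)$. For $v\in T_pP$, $g\in G$, $Z\in L(G)$: $vg\in T_{pg}P$ is the image of $v$ under the derivative of $p\mapsto pg$, and $pZ=\frac{d}{du}|_{u=0}p\exp(uZ)$. A vector is vertical if $\pi_*$ maps it to $0$. A form $\Theta$ on $P$ of degree $k$ ($k=1,2$) with values in $L(G)$ or $L(H)$ is equivariant if $\Theta_{pg}(v_1g,\dots,v_kg)=\mathrm{Ad}(g^{-1})\Theta_p(v_1,\dots,v_k)$ for all $g\in G$, and horizontal if it is $0$ whenever one of its arguments is vertical. $\mathcal{P}M$ is the set of $C^\infty$ paths $[t_0,t_1]\to M$ constant near $t_0$ and near $t_1$, with paths differing by a time translation identified. $\mathcal{P}_{\bar A}P$ is the set of $C^\infty$ paths $\bar\gamma:[t_0,t_1]\to P$, constant near $t_0$ and $t_1$, with $\bar A(\bar\gamma'(t))=0$ for all $t$, with the same identification. $T_{\bar\gamma}\mathcal{P}_{\bar A}P$ is the vector space of $C^\infty$ vector fields $\bar v$ along $\bar\gamma$, constant near $t_0$ and $t_1$, with $\frac{\partial}{\partial t}\bar A(\bar v(t))=F^{\bar A}(\bar\gamma'(t),\bar v(t))$, where $F^{\bar A}$ is the curvature of $\bar A$. The projection $\mathcal{P}^{\rm dec}_{\bar A}P\to\mathcal{P}M$ is $(\bar\gamma,h)\mapsto\pi\circ\bar\gamma$, the tangent space is $T_{(\bar\gamma,h)}\mathcal{P}^{\rm dec}_{\bar A}P=T_{\bar\gamma}\mathcal{P}_{\bar A}P\oplus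 T_hH$, with elements written $\bar v+X$ or $(\bar v,X)$, and the right action of $H\rtimes_\alpha G$ is $(\bar\gamma,h)h_1g_1=(\bar\gamma g_1,\alpha(g_1^{-1})(hh_1))=(\bar\gamma g_1,g_1^{-1}hh_1g_1)$. The derivative of the action of $(h_1,g_1)$ is $\mathcal{R}_{(h_1,g_1)*}(\bar v+X)=\bar vg_1+g_1^{-1}(Xh_1)g_1$, where $(\bar vg_1)(t)=\bar v(t)g_1$, $Xh_1\in T_{hh_1}H$ is the image of $X$ under the derivative of $x\mapsto xh_1$, and $g_1^{-1}(Xh_1)g_1$ is the image of $Xh_1$ under the derivative of $\alpha(g_1^{-1})$ at $hh_1$. The derivative at the identity of the orbit map $(h_1,g_1)\mapsto(\bar\gamma,h)h_1g_1$ is $$r_{(\bar\gamma,h)}:L(H\rtimes_\alpha G)\to T_{(\bar\gamma,h)}\mathcal{P}^{\rm dec}_{\bar A}P,\quad Y_1+Z_1\mapsto\bar\gamma Z_1+h\big(Y_1+(1-\mathrm{Ad}(h^{-1}))Z_1\big),$$ where $(\bar\gamma Z_1)(t)=\bar\gamma(t)Z_1$, $(1-\mathrm{Ad}(h^{-1}))Z_1\in L(H)$, and $hW\in T_hH$ for $W\in L(H)$ is the left translate. $Xh^{-1}\in L(H)$ is the right translate of $X\in T_hH$. *)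

(* Defs.v *)
From HB Require Import structures.
From mathcomp Require Import all_boot all_order all_algebra.
From mathcomp Require Import all_classical all_reals all_analysis.

Set Implicit Arguments.
Unset Strict Implicit.
Unset Printing Implicit Defensive.

Import Order.TTheory GRing.Theory Num.Theory.
Import numFieldNormedType.Exports.

Local Open Scope classical_set_scope.
Local Open Scope ring_scope.

(* [U] is meant to be open; in finite dimension [smooth_on U f] says that all
   iterated directional derivatives of [f] exist and are continuous on [U]. *)
Fixpoint Ck_on (R : realType) (V W : normedModType R) (k : nat)
    (U : set V) (f : V -> W) : Prop :=
  if k is k'.+1 then
    (forall x, U x -> differentiable f x) /\
    (forall v : V, Ck_on k' U (fun x => 'D_v f x))
  else forall x, U x -> {for x, continuous f}.

Definition smooth_on (R : realType) (V W : normedModType R)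
    (U : set V) (f : V -> W) : Prop := forall k, Ck_on k U f.

Definition smooth_at (R : realType) (V W : normedModType R)
    (f : V -> W) (x : V) : Prop := exists2 U, open_nbhs x U & smooth_on U f.

(* The atlas is indexed by the points: [chart p] is a chart around [p], with
   domain [chart_dom p] and inverse [chart_inv p].  These functions are total;
   only their values on [chart_dom p], resp. on its image, matter.  The tangent
   space T_pM is ['rV[R]_(dim M)], a tangent vector at [p] being given by its
   coordinates in the chart [chart p]. *)
Record mfdData (R : realType) := MfdData {
  pts :> topologicalType;
  dim : nat;
  chart_dom : pts -> set pts;
  chart : pts -> pts -> 'rV[R]_dim;
  chart_inv : pts -> 'rV[R]_dim -> pts }.

Definition tangent (R : realType) (M : mfdData R) : normedModType R :=
  'rV[R]_(dim M).

Definition is_manifold (R : realType) (M : mfdData R) : Prop :=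
  [/\ hausdorff_space M, @second_countable M,
   forall p : M,
     [/\ chart_dom p p, open (chart_dom p),
         open (chart p @` chart_dom p),
         {in chart_dom p, cancel (chart p) (chart_inv p)} &
         (forall q, chart_dom p q -> {for q, continuous (chart p)}) /\
         (forall x, (chart p @` chart_dom p) x ->
            {for x, continuous (chart_inv p)})] &
   forall p q : M,
     smooth_on (chart p @` (chart_dom p `&` chart_dom q))
               (chart q \o chart_inv p)].

Definition prod_mfd (R : realType) (M N : mfdData R) : mfdData R :=
  @MfdData R (M * N)%type (dim M + dim N)
    (fun p => chart_dom p.1 `*` chart_dom p.2)
    (fun p q => row_mx (chart p.1 q.1) (chart p.2 q.2))
    (fun p x => (chart_inv p.1 (lsubmx x), chart_inv p.2 (rsubmx x))).

Definition msmooth_at (R : realType) (M N : mfdData R) (f : M -> N) (p : M) :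
    Prop :=
  {for p, continuous f} /\
  smooth_at (chart (f p) \o f \o chart_inv p) (chart p p).

Definition msmooth_on (R : realType) (M N : mfdData R) (U : set M)
    (f : M -> N) : Prop := forall p, U p -> msmooth_at f p.

Definition msmooth (R : realType) (M N : mfdData R) (f : M -> N) : Prop :=
  forall p, msmooth_at f p.

(* The derivative T_pM -> T_{f p}N. *)
Definition mdiff (R : realType) (M N : mfdData R) (f : M -> N) (p : M)
    (v : tangent M) : tangent N :=
  'd (chart (f p) \o f \o chart_inv p) (chart p p) v.

(* Coordinates in the chart around [q] of a tangent vector [v] at [p]. *)
Definition tcoord (R : realType) (M : mfdData R) (q p : M) (v : tangent M) :
    'rV[R]_(dim M) :=
  'd (chart q \o chart_inv p) (chart p p) v.

(* The tangent vector at [chart_inv p x] whose coordinates in the chart around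
   [p] are [e]. *)
Definition tframe (R : realType) (M : mfdData R) (p : M)
    (x e : 'rV[R]_(dim M)) : tangent M :=
  'd (chart (chart_inv p x) \o chart_inv p) x e.

Definition smooth_curve (R : realType) (M : mfdData R) (c : R -> M) : Prop :=
  continuous c /\
  forall t : R, @smooth_at R R^o 'rV[R]_(dim M) (chart (c t) \o c) t.

Definition velocity (R : realType) (M : mfdData R) (c : R -> M) (t : R) :
    tangent M := derive1 (chart (c t) \o c) t.

Definition smooth_field_along (R : realType) (M : mfdData R) (c : R -> M)
    (v : R -> tangent M) : Prop :=
  forall t : R,
    @smooth_at R R^o 'rV[R]_(dim M) (fun s => tcoord (c t) (c s) (v s)) t.

Record lieData (R : realType) := LieData {
  lie_mfd :> mfdData R;
  lmul : lie_mfd -> lie_mfd -> lie_mfd;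
  lone : lie_mfd;
  linv : lie_mfd -> lie_mfd }.

Arguments lone {R} _.

Local Notation "x ** y" := (lmul x y) (at level 40, left associativity).

Definition is_lie_group (R : realType) (G : lieData R) : Prop :=
  [/\ is_manifold G,
      [/\ associative (@lmul R G), left_id (lone G) (@lmul R G),
          right_id (lone G) (@lmul R G),
          left_inverse (lone G) (@linv R G) (@lmul R G) &
          right_inverse (lone G) (@linv R G) (@lmul R G)],
      @msmooth R (prod_mfd G G) G (fun x => x.1 ** x.2) &
      @msmooth R G G (@linv R G)].

(* L(G) is the tangent space at the identity. *)
Definition lie_alg (R : realType) (G : lieData R) : normedModType R :=
  'rV[R]_(dim G).

Definition Ad (R : realType) (G : lieData R) (g : G) (Z : lie_alg G) :
    lie_alg G :=
  @mdiff R G G (fun x => g ** x ** linv g) (lone G) Z.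

(* The bracket of L(G) is the derivative of Ad at the identity. *)
Definition lie_bracket (R : realType) (G : lieData R) (X Y : lie_alg G) :
    lie_alg G :=
  'd (fun x : 'rV[R]_(dim G) => Ad (chart_inv (lone G) x) Y)
     (chart (lone G) (lone G)) X.

(* [expu Z u] is exp(uZ): [expu Z] is the one-parameter subgroup of [G] with
   initial velocity [Z]. *)
Definition expu (R : realType) (G : lieData R) (Z : lie_alg G) : R -> G :=
  xget (fun=> lone G)
    [set c : R -> G | [/\ smooth_curve c,
                          forall s t, c (s + t) = c s ** c t &
                          velocity c 0 = Z]].

Definition is_lie_crossed_module (R : realType) (G H : lieData R)
    (alpha : G -> H -> H) (tau : H -> G) : Prop :=
  [/\ is_lie_group G /\ is_lie_group H,
      msmooth tau /\ {morph tau : h h' / h ** h' >-> h ** h'},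
      [/\ forall g, {morph alpha g : h h' / h ** h' >-> h ** h'},
          forall h, alpha (lone G) h = h,
          forall g g' h, alpha (g ** g') h = alpha g (alpha g' h) &
          @msmooth R (prod_mfd G H) H (fun x => alpha x.1 x.2)],
      forall g h, tau (alpha g h) = g ** tau h ** linv g &
      forall h h', alpha (tau h) h' = h ** h' ** linv h].

(* As a manifold this is H x G, so that a tangent vector at the identity
   (1, 1) is [row_mx Y Z] with [Y] in L(H) and [Z] in L(G). *)
Definition semidirect (R : realType) (G H : lieData R) (alpha : G -> H -> H) :
    lieData R :=
  @LieData R (prod_mfd H G)
    (fun x y => (x.1 ** alpha x.2 y.1, x.2 ** y.2))
    (lone H, lone G)
    (fun x => (alpha (linv x.2) (linv x.1), linv x.2)).

Definition sd_pair (R : realType) (G H : lieData R) (alpha : G -> H -> H)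
    (h : H) (g : G) : semidirect alpha := (h, g).

Definition sd_lie (R : realType) (G H : lieData R) (alpha : G -> H -> H)
    (Y : lie_alg H) (Z : lie_alg G) : lie_alg (semidirect alpha) := row_mx Y Z.

(* The action d(alpha g)|_e of G on L(H), i.e. the restriction of Ad(g). *)
Definition dalpha (R : realType) (G H : lieData R) (alpha : G -> H -> H)
    (g : G) (Y : lie_alg H) : lie_alg H :=
  @mdiff R H H (alpha g) (lone H) Y.

(* Around each point of [M] there is a local trivialization p |-> (pi p, Phi p)
   with inverse (m, g) |-> Psi (m, g). *)
Definition is_principal_bundle (R : realType) (G : lieData R) (P M : mfdData R)
    (pi : P -> M) (act : P -> G -> P) : Prop :=
  [/\ [/\ is_lie_group G, is_manifold P & is_manifold M],
      msmooth pi,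
      [/\ @msmooth R (prod_mfd P G) P (fun x => act x.1 x.2),
          forall p, act p (lone G) = p,
          forall p g g', act p (g ** g') = act (act p g) g' &
          forall p g, pi (act p g) = pi p] &
      forall m : M, exists (U : set M) (Phi : P -> G) (Psi : prod_mfd M G -> P),
        [/\ open_nbhs m U,
            msmooth_on (pi @^-1` U) Phi /\
              @msmooth_on R (prod_mfd M G) P (U `*` setT) Psi,
            forall p, U (pi p) -> Psi (pi p, Phi p) = p,
            forall n g, U n -> pi (Psi (n, g)) = n /\ Phi (Psi (n, g)) = g &
            forall p g, U (pi p) -> Phi (act p g) = Phi p ** g]].

(* The vector vg of T_{pg}P, for v in T_pP. *)
Definition tact (R : realType) (G : lieData R) (P : mfdData R)
    (act : P -> G -> P) (p : P) (v : tangent P) (g : G) : tangent P :=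
  @mdiff R P P (act^~ g) p v.

(* The vector pZ of T_pP, for Z in L(G). *)
Definition fund (R : realType) (G : lieData R) (P : mfdData R)
    (act : P -> G -> P) (p : P) (Z : lie_alg G) : tangent P :=
  velocity (fun u => act p (expu Z u)) 0.

Definition vertical (R : realType) (P M : mfdData R) (pi : P -> M)
    (p : P) (v : tangent P) : Prop := mdiff pi p v = 0.

Definition is_form1 (R : realType) (P : mfdData R) (L : normedModType R)
    (Theta : P -> tangent P -> L) : Prop :=
  (forall p, linear (Theta p)) /\
  forall (p : P) e, smooth_at
    (fun x => Theta (chart_inv p x) (tframe p x e)) (chart p p).

Definition is_form2 (R : realType) (P : mfdData R) (L : normedModType R)
    (Theta : P -> tangent P -> tangent P -> L) : Prop :=
  [/\ forall p v, linear (Theta p v),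
      forall p w, linear (Theta p ^~ w),
      forall p v, Theta p v v = 0 &
      forall (p : P) e e', smooth_at
        (fun x => Theta (chart_inv p x) (tframe p x e) (tframe p x e'))
        (chart p p)].

(* Equivariance, for an action [rho] of G on [L]: Ad on L(G), dalpha on L(H). *)
Definition equivariant1 (R : realType) (G : lieData R) (P : mfdData R)
    (act : P -> G -> P) (L : normedModType R) (rho : G -> L -> L)
    (Theta : P -> tangent P -> L) : Prop :=
  forall p g v, Theta (act p g) (tact act p v g) = rho (linv g) (Theta p v).

Definition equivariant2 (R : realType) (G : lieData R) (P : mfdData R)
    (act : P -> G -> P) (L : normedModType R) (rho : G -> L -> L)
    (Theta : P -> tangent P -> tangent P -> L) : Prop :=
  forall p g v w, Theta (act p g) (tact act p v g) (tact act p w g) =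
    rho (linv g) (Theta p v w).

Definition horizontal1 (R : realType) (P M : mfdData R) (pi : P -> M)
    (L : normedModType R) (Theta : P -> tangent P -> L) : Prop :=
  forall p v, vertical pi p v -> Theta p v = 0.

Definition horizontal2 (R : realType) (P M : mfdData R) (pi : P -> M)
    (L : normedModType R) (Theta : P -> tangent P -> tangent P -> L) : Prop :=
  forall p v w, vertical pi p v \/ vertical pi p w -> Theta p v w = 0.

Definition eqhor_form1 (R : realType) (G : lieData R) (P M : mfdData R)
    (pi : P -> M) (act : P -> G -> P) (L : normedModType R)
    (rho : G -> L -> L) (Theta : P -> tangent P -> L) : Prop :=
  [/\ is_form1 Theta, equivariant1 act rho Theta & horizontal1 pi Theta].

Definition eqhor_form2 (R : realType) (G : lieData R) (P M : mfdData R)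
    (pi : P -> M) (act : P -> G -> P) (L : normedModType R)
    (rho : G -> L -> L) (Theta : P -> tangent P -> tangent P -> L) : Prop :=
  [/\ is_form2 Theta, equivariant2 act rho Theta & horizontal2 pi Theta].

Definition is_connection (R : realType) (G : lieData R) (P : mfdData R)
    (act : P -> G -> P) (A : P -> tangent P -> lie_alg G) : Prop :=
  [/\ is_form1 A, equivariant1 act (@Ad R G) A &
      forall p Z, A p (fund act p Z) = Z].

(* dTheta(v, w) = v(Theta(w)) - w(Theta(v)) for the vector fields that have
   constant coordinates in the chart around [p]. *)
Definition ext_deriv (R : realType) (P : mfdData R) (L : normedModType R)
    (Theta : P -> tangent P -> L) (p : P) (v w : tangent P) : L :=
  let theta e x := Theta (chart_inv p x) (tframe p x e) in
  'D_v (theta w) (chart p p) - 'D_w (theta v) (chart p p).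

Definition curvature (R : realType) (G : lieData R) (P : mfdData R)
    (A : P -> tangent P -> lie_alg G) (p : P) (v w : tangent P) : lie_alg G :=
  ext_deriv A p v w + lie_bracket (A p v) (A p w).

(* A map on [t0, t1] that is constant near [t0] and near [t1] is represented
   by its extension to R that is constant on either side of ]t0, t1[.  Paths are
   not quotiented by time translations: what follows is invariant under
   translating (t0, t1, c, v), and is stated for every representative. *)
Definition const_near_ends (R : realType) (T : Type) (t0 t1 : R)
    (f : R -> T) : Prop :=
  exists2 e : R, 0 < e &
    (forall t, t <= t0 + e -> f t = f t0) /\
    (forall t, t1 - e <= t -> f t = f t1).

Definition is_path (R : realType) (P : mfdData R) (t0 t1 : R) (c : R -> P) :
    Prop :=
  [/\ t0 < t1, smooth_curve c & const_near_ends t0 t1 c].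

Definition is_hor_path (R : realType) (G : lieData R) (P : mfdData R)
    (Abar : P -> tangent P -> lie_alg G) (t0 t1 : R) (c : R -> P) : Prop :=
  is_path t0 t1 c /\
  forall t, t0 <= t <= t1 -> Abar (c t) (velocity c t) = 0.

Definition is_path_tangent (R : realType) (G : lieData R) (P : mfdData R)
    (Abar : P -> tangent P -> lie_alg G) (t0 t1 : R) (c : R -> P)
    (v : R -> tangent P) : Prop :=
  [/\ smooth_field_along c v, const_near_ends t0 t1 v &
      forall t, t0 <= t <= t1 ->
        derive1 (fun s => Abar (c s) (v s)) t =
        curvature Abar (c t) (velocity c t) (v t)].

Definition vint (R : realType) (n : nat) (t0 t1 : R) (f : R -> 'rV[R]_n) :
    'rV[R]_n :=
  \row_i \int[lebesgue_measure]_(t in `[t0, t1]) (f t ord0 i).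

(* A point of the decorated path space is a pair (c, h), a tangent vector at
   it is a pair (v, X), with [X] in T_hH. *)

Definition dec_act (R : realType) (G H : lieData R) (alpha : G -> H -> H)
    (P : mfdData R) (act : P -> G -> P) (x : (R -> P) * H) (h1 : H) (g1 : G) :
    (R -> P) * H :=
  (fun t => act (x.1 t) g1, alpha (linv g1) (x.2 ** h1)).

Definition dec_tact (R : realType) (G H : lieData R) (alpha : G -> H -> H)
    (P : mfdData R) (act : P -> G -> P) (x : (R -> P) * H) (h1 : H) (g1 : G)
    (V : (R -> tangent P) * tangent H) : (R -> tangent P) * tangent H :=
  (fun t => tact act (x.1 t) (V.1 t) g1,
   @mdiff R H H (alpha (linv g1)) (x.2 ** h1)
     (@mdiff R H H (fun y => y ** h1) x.2 V.2)).

(* The component [lsubmx] is the one in L(H); that of (1 - Ad(h^-1))Z in L(G)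
   vanishes. *)
Definition dec_orbit (R : realType) (G H : lieData R) (alpha : G -> H -> H)
    (P : mfdData R) (act : P -> G -> P) (x : (R -> P) * H)
    (Y : lie_alg H) (Z : lie_alg G) : (R -> tangent P) * tangent H :=
  let Zsd := sd_lie alpha 0 Z in
  let W : 'rV[R]_(dim H + dim G) :=
    Zsd - Ad (sd_pair alpha (linv x.2) (lone G)) Zsd in
  (fun t => fund act (x.1 t) Z,
   @mdiff R H H (fun y => x.2 ** y) (lone H) (Y + lsubmx W)).

Definition omega (R : realType) (G : lieData R) (P : mfdData R)
    (A : P -> tangent P -> lie_alg G)
    (B0 : P -> tangent P -> tangent P -> lie_alg G)
    (C0L C0R : P -> tangent P -> lie_alg G)
    (t0 t1 : R) (c : R -> P) (v : R -> tangent P) : lie_alg G :=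
  A (c t0) (v t0) + C0R (c t1) (v t1) - C0L (c t0) (v t0)
  + vint t0 t1 (fun t => B0 (c t) (v t) (velocity c t)).

Definition Omega (R : realType) (G H : lieData R) (alpha : G -> H -> H)
    (P : mfdData R)
    (A : P -> tangent P -> lie_alg G)
    (B0 : P -> tangent P -> tangent P -> lie_alg G)
    (B1 : P -> tangent P -> tangent P -> lie_alg H)
    (C0L C0R : P -> tangent P -> lie_alg G)
    (C1L C1R : P -> tangent P -> lie_alg H)
    (t0 t1 : R) (x : (R -> P) * H) (V : (R -> tangent P) * tangent H) :
    lie_alg (semidirect alpha) :=
  let c := x.1 in let h := x.2 in let v := V.1 in let X := V.2 in
  Ad (sd_pair alpha (linv h) (lone G))
    (sd_lie alpha
      (C1R (c t1) (v t1) - C1L (c t0) (v t0)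
       + vint t0 t1 (fun t => B1 (c t) (v t) (velocity c t))
       + @mdiff R H H (fun y => y ** linv h) h X)
      (omega A B0 C0L C0R t0 t1 c v)).

(* Main.v *)
From HB Require Import structures.
Require Import Defs.
From mathcomp Require Import all_boot all_order all_algebra.
From mathcomp Require Import all_classical all_reals all_analysis.
Local Open Scope ring_scope.

Set Implicit Arguments.
Unset Strict Implicit.
Unset Printing Implicit Defensive.

Import Order.TTheory GRing.Theory Num.Theory.
Import numFieldNormedType.Exports.

Local Open Scope classical_set_scope.

(** Both claims are pointwise computations with derivatives, once the chain
    rule is available for maps between manifolds given by charts.

    Equivariance.  Write g = g1^-1, h' = alpha g (h h1), and let U in L(H) and
    W in L(G) be the two components of the bracket on which Ad(h^-1) acts in
    Omega.  Moving the data by (h1, g1) replaces U by dalpha g U and W by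
    Ad g W.  For the terms that come from the forms this is their equivariance,
    the velocity of the translated path being the translate of the velocity;
    under the integral sign it also needs that the linear maps Ad g and
    dalpha g commute with the integral, hence that the integrands are
    integrable, and they are in fact continuous in t ([form2_along_continuous],
    [vint_linear]).  For the term X h^-1 it is the identity
      alpha g (y h1) h'^-1 = alpha g (y h^-1)
    differentiated at y = h ([translate_alpha]).  Since the pair
    (dalpha g U, Ad g W) is Ad g (U + W) in the semidirect product
    ([Ad_sd_G]), the claim reduces to h'^-1 g1^-1 = (h1 g1)^-1 h^-1 and to the
    multiplicativity of Ad ([AdM]).

    Orbit directions.  The vectors p Z are vertical ([fund_vertical]), so every
    horizontal form drops out and omega returns Z1.  With
    V = Y1 + (1 - Ad(h^-1)) Z1, the H-direction contributes (h V) h^-1 = Ad(h) V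
    ([right_translate_left]), and Ad(h^-1)(Ad(h) V + Z1) = V + Ad(h^-1) Z1.
    This is Y1 + Z1, because conjugation by h does not change the
    G-component ([rsubmx_Ad_sd_H]). *)

(** * Derivatives on normed spaces *)

(** The derivative depends only on the germ of the function: maps read in
    charts agree with the expected ones only near the base point. *)
Lemma near_eq_is_diff (R : realType) (V W : normedModType R)
    (f g df : V -> W) (x : V) :
  (\forall y \near x, f y = g y) -> is_diff x g df -> is_diff x f df.
Proof.
move=> fg [dg <-].
have df_lin : f \o shift x = cst (f x) + 'd g x +o_ (0 : V) id.
  apply/eqaddoP; have /eqaddoP := diff_locally dg; move=> go e e0.
  have := go e e0; apply: filter_app.
  rewrite (nbhs_singleton fg).
  suff : \forall y \near (0 : V), f (y + x) = g (y + x).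
    by apply: filterS => y fgy; rewrite !fctE /= fgy.
  by move: fg; rewrite (near_shift 0) subr0; exact: filterS.
have dfE := diff_unique (diff_continuous dg) df_lin.
split=> //; apply/diff_locallyP; rewrite dfE; split=> //.
exact: diff_continuous.
Qed.

Lemma linear_rV_continuous (R : realType) (n : nat) (W : normedModType R)
    (L : {linear 'rV[R]_n -> W}) : continuous L.
Proof.
move=> x; apply: differentiable_continuous.
have -> : (L : _ -> _) =
    \sum_(j < n) (fun u : 'rV[R]_n => u ord0 j *: L (delta_mx 0 j)).
  apply/funext => u; rewrite fct_sumE {1}(row_sum_delta u) linear_sum.
  by apply: eq_bigr => j _; rewrite linearZ.
apply: differentiable_sum => j; apply: differentiableZl.
exact: differentiable_coord.
Qed.

(** The two summands of [row_mx] as linear maps, so that pairing of functions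
    inherits continuity and differentiability from sums. *)
Definition inl_mx (R : realType) (m n : nat) :
  {linear 'rV[R]_m -> 'rV[R]_(m + n)} := mulmxr (row_mx 1%:M 0).

Definition inr_mx (R : realType) (m n : nat) :
  {linear 'rV[R]_n -> 'rV[R]_(m + n)} := mulmxr (row_mx 0 1%:M).

Lemma row_mx_inlr (R : realType) (m n : nat) (a : 'rV[R]_m) (b : 'rV[R]_n) :
  row_mx a b = inl_mx R m n a + inr_mx R m n b.
Proof.
by rewrite /inl_mx /inr_mx /= !mul_mx_row !mulmx1 !mulmx0 add_row_mx addr0 add0r.
Qed.

Lemma cvg_row_mx (R : realType) (T : Type) (F : set_system T) {FF : Filter F}
    (m n : nat) (f : T -> 'rV[R]_m) (g : T -> 'rV[R]_n)
    (a : 'rV[R]_m) (b : 'rV[R]_n) :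
  f @ F --> a -> g @ F --> b ->
  (fun x => row_mx (f x) (g x)) @ F --> row_mx a b.
Proof.
move=> fa gb.
have -> : (fun x => row_mx (f x) (g x)) =
    ((inl_mx R m n \o f) \+ (inr_mx R m n \o g)).
  by apply/funext => x; rewrite row_mx_inlr.
rewrite row_mx_inlr; apply: cvgD.
- by apply: cvg_comp; [exact: fa|exact: linear_rV_continuous].
- by apply: cvg_comp; [exact: gb|exact: linear_rV_continuous].
Qed.

Lemma is_diff_linear_rV (R : realType) (n : nat) (W : normedModType R)
    (L : {linear 'rV[R]_n -> W}) (x : 'rV[R]_n) : is_diff x L L.
Proof.
have c : continuous L by exact: linear_rV_continuous.
by split; [exact: linear_differentiable|exact: diff_lin].
Qed.

Lemma is_diff_row_mx (R : realType) (V : normedModType R) (m n : nat)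
    (f df : V -> 'rV[R]_m) (g dg : V -> 'rV[R]_n) (x : V) :
  is_diff x f df -> is_diff x g dg ->
  is_diff x (fun y => row_mx (f y) (g y)) (fun y => row_mx (df y) (dg y)).
Proof.
move=> hf hg.
have rowE u v : (fun y : V => row_mx (u y) (v y)) =
    (inl_mx R m n \o u) + (inr_mx R m n \o v).
  by apply/funext => y; rewrite row_mx_inlr.
rewrite !rowE; have dl := is_diff_linear_rV (inl_mx R m n) (f x).
by have dr := is_diff_linear_rV (inr_mx R m n) (g x); exact: is_diffD.
Qed.

(** * The derivative of maps between manifolds *)

(** All that first-order calculus needs of a manifold: the chart around a point
    and its inverse are continuous there and inverse to each other nearby.
    This passes to products factor by factor. *)
Definition charted (R : realType) (M : mfdData R) : Prop := forall p : M,
  [/\ \forall q \near p, chart_inv p (chart p q) = q,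
      \forall x \near chart p p, chart p (chart_inv p x) = x,
      {for p, continuous (chart p)} &
      {for chart p p, continuous (chart_inv p)}].

Lemma manifold_charted (R : realType) (M : mfdData R) :
  is_manifold M -> charted M.
Proof.
move=> [_ _ hM _] p; have [pp op oim inv_chart [cc ci]] := hM p.
have pim : (chart p @` chart_dom p) (chart p p) by exists p.
split.
- have : nbhs p (chart_dom p) by apply: open_nbhs_nbhs; split.
  by apply: filterS => q pq; apply: inv_chart; rewrite inE.
- have : nbhs (chart p p) (chart p @` chart_dom p).
    by apply: open_nbhs_nbhs; split.
  by apply: filterS => _ [q pq <-]; rewrite inv_chart // inE.
- exact: cc.
- exact: ci.
Qed.

Lemma chart_invK (R : realType) (M : mfdData R) (p : M) :
  charted M -> chart_inv p (chart p p) = p.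
Proof. by move=> hM; have [/nbhs_singleton] := hM p. Qed.

Lemma charted_prod (R : realType) (M N : mfdData R) :
  charted M -> charted N -> charted (prod_mfd M N).
Proof.
move=> hM hN [p q]; have [p1 p2 p3 p4] := hM p; have [q1 q2 q3 q4] := hN q.
have lc := @continuous_lsubmx R 1 _ _ (row_mx (chart p p) (chart q q)).
have rc := @continuous_rsubmx R 1 _ _ (row_mx (chart p p) (chart q q)).
rewrite /continuous_at row_mxKl in lc; rewrite /continuous_at row_mxKr in rc.
split.
- exists ([set x | chart_inv p (chart p x) = x],
          [set x | chart_inv q (chart q x) = x]) => //.
  by move=> [x y] [/= ex ey]; rewrite row_mxKl row_mxKr ex ey.
- have near_p : \forall x \near row_mx (chart p p) (chart q q),
      chart p (chart_inv p (lsubmx x)) = lsubmx x by exact: lc _ p2.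
  have near_q : \forall x \near row_mx (chart p p) (chart q q),
      chart q (chart_inv q (rsubmx x)) = rsubmx x by exact: rc _ q2.
  near=> x; rewrite /= (near near_p x) // (near near_q x) //.
  by rewrite hsubmxK.
- rewrite /=; apply: cvg_row_mx.
  + by apply: (@cvg_comp _ _ _ fst (chart p)); [exact: cvg_fst|exact: p3].
  + by apply: (@cvg_comp _ _ _ snd (chart q)); [exact: cvg_snd|exact: q3].
- rewrite /= /prop_for /continuous_at; cbn beta; rewrite row_mxKl row_mxKr.
  exact: (cvg_pair (cvg_comp _ _ lc p4) (cvg_comp _ _ rc q4)).
Unshelve. all: by end_near. Qed.

(** The common source of all chain rules below.  The domain of [u] is a normed
    space, so that [u] may be a curve or a map read in a chart of its source;
    the codomain of [F] is one too, so that [F] may be a map followed by any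
    chart of its target. *)
Lemma is_diff_chart_chain (R : realType) (M : mfdData R)
    (V W : normedModType R) (u : V -> M) (x : V) (F : M -> W)
    (du : V -> tangent M) (dF : tangent M -> W) :
  charted M -> {for x, continuous u} -> is_diff x (chart (u x) \o u) du ->
  is_diff (chart (u x) (u x)) (F \o chart_inv (u x)) dF ->
  is_diff x (F \o u) (dF \o du).
Proof.
move=> hM uc hu hF.
apply: (@near_eq_is_diff _ _ _ _
  ((F \o chart_inv (u x)) \o (chart (u x) \o u))).
have [near_inv _ _ _] := hM (u x).
have near_x : \forall y \near x, chart_inv (u x) (chart (u x) (u y)) = u y.
  exact: uc _ near_inv.
by near=> y; rewrite /= (near near_x y).
Unshelve. all: by end_near. Qed.

(** First-order differentiability.  It is preserved by composition through the
    chain rule alone, whereas smoothness of a composite would require the chain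
    rule for all higher derivatives. *)
Definition is_mdiff (R : realType) (M N : mfdData R) (p : M) (f : M -> N)
    (df : tangent M -> tangent N) : Prop :=
  {for p, continuous f} /\
  is_diff (chart p p) (chart (f p) \o f \o chart_inv p) df.

Lemma is_mdiffE (R : realType) (M N : mfdData R) (p : M) (f : M -> N) df v :
  is_mdiff p f df -> mdiff f p v = df v.
Proof. by move=> [_ [_ <-]]. Qed.

Lemma msmooth_mdiff (R : realType) (M N : mfdData R) (p : M) (f : M -> N) :
  msmooth_at f p -> is_mdiff p f (mdiff f p).
Proof.
move=> [fc [U [_ Up] fU]]; split => //; split => //.
by have [/(_ _ Up)] := fU 1%N.
Qed.

Lemma is_mdiff_comp (R : realType) (L M N : mfdData R) (p : L)
    (g : L -> M) (f : M -> N) dg df :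
  charted L -> charted M -> is_mdiff p g dg -> is_mdiff (g p) f df ->
  is_mdiff p (f \o g) (df \o dg).
Proof.
move=> hL hM [gc gd] [fc fd]; split; first exact: continuous_comp.
have [_ _ _ ic] := hL p; have pK := chart_invK p hL.
have := @is_diff_chart_chain R M _ _ (g \o chart_inv p) (chart p p)
  (chart (f (g p)) \o f) dg df hM.
rewrite /= pK; apply => //.
by apply: continuous_comp => //; rewrite pK.
Qed.

Lemma is_mdiff_id (R : realType) (M : mfdData R) (p : M) :
  charted M -> is_mdiff p (@id M) id.
Proof.
move=> hM; split; first exact: cvg_id.
have [_ near_chart _ _] := hM p.
by apply: (@near_eq_is_diff _ _ _ _ id) => //; exact: is_diff_id.
Qed.

Lemma is_mdiff_cst (R : realType) (M N : mfdData R) (p : M) (q : N) :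
  is_mdiff p (fun=> q) (fun=> 0).
Proof. by split; [exact: cvg_cst|exact: is_diff_cst]. Qed.

Lemma is_mdiff_pair (R : realType) (L M N : mfdData R) (p : L)
    (f : L -> M) (g : L -> N) df dg :
  is_mdiff p f df -> is_mdiff p g dg ->
  @is_mdiff R L (prod_mfd M N) p (fun x => (f x, g x))
    (fun v => row_mx (df v) (dg v)).
Proof.
move=> [fc fd] [gc gd]; split; first exact: cvg_pair.
exact: is_diff_row_mx.
Qed.

Lemma is_mdiff_fst (R : realType) (M N : mfdData R) (p : prod_mfd M N) :
  charted M -> @is_mdiff R (prod_mfd M N) M p fst lsubmx.
Proof.
move=> hM; split; first exact: cvg_fst.
have [_ near_chart _ _] := hM p.1.
have lc := @continuous_lsubmx R 1 _ _ (chart p p).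
rewrite /continuous_at row_mxKl in lc.
apply: (@near_eq_is_diff _ _ _ _ lsubmx); first by have := lc _ near_chart.
exact: is_diff_linear_rV.
Qed.

Lemma is_mdiff_snd (R : realType) (M N : mfdData R) (p : prod_mfd M N) :
  charted N -> @is_mdiff R (prod_mfd M N) N p snd rsubmx.
Proof.
move=> hN; split; first exact: cvg_snd.
have [_ near_chart _ _] := hN p.2.
have rc := @continuous_rsubmx R 1 _ _ (chart p p).
rewrite /continuous_at row_mxKr in rc.
apply: (@near_eq_is_diff _ _ _ _ rsubmx); first by have := rc _ near_chart.
exact: is_diff_linear_rV.
Qed.

Definition mdiffble (R : realType) (M N : mfdData R) (f : M -> N) (p : M) :
  Prop := is_mdiff p f (mdiff f p).

Lemma is_mdiff_mdiffble (R : realType) (M N : mfdData R) (p : M) (f : M -> N)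
    df : is_mdiff p f df -> mdiffble f p.
Proof. by move=> [fc [fd _]]; split => //; split. Qed.

Lemma mdiffble_comp (R : realType) (L M N : mfdData R) (p : L)
    (g : L -> M) (f : M -> N) :
  charted L -> charted M -> mdiffble g p -> mdiffble f (g p) ->
  mdiffble (fun x => f (g x)) p.
Proof.
by move=> hL hM hg hf; exact: is_mdiff_mdiffble (is_mdiff_comp hL hM hg hf).
Qed.

(** The middle point [q] is kept apart from [g p]: in a group it is typically
    [lone] or a product that equals [g p] only propositionally. *)
Lemma mdiff_comp (R : realType) (L M N : mfdData R) (p : L) (q : M)
    (g : L -> M) (f : M -> N) v :
  charted L -> charted M -> g p = q -> mdiffble g p -> mdiffble f q ->
  mdiff (fun x => f (g x)) p v = mdiff f q (mdiff g p v).
Proof.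
by move=> hL hM <- hg hf; exact: is_mdiffE (is_mdiff_comp hL hM hg hf).
Qed.

Lemma mdiffble_pair (R : realType) (L M N : mfdData R) (p : L)
    (f : L -> M) (g : L -> N) :
  mdiffble f p -> mdiffble g p ->
  @mdiffble R L (prod_mfd M N) (fun x => (f x, g x)) p.
Proof. by move=> hf hg; exact: is_mdiff_mdiffble (is_mdiff_pair hf hg). Qed.

Lemma mdiff_pair (R : realType) (L M N : mfdData R) (p : L)
    (f : L -> M) (g : L -> N) v :
  mdiffble f p -> mdiffble g p ->
  @mdiff R L (prod_mfd M N) (fun x => (f x, g x)) p v =
  row_mx (mdiff f p v) (mdiff g p v).
Proof. by move=> hf hg; exact: is_mdiffE (is_mdiff_pair hf hg). Qed.

Lemma mdiffble_id (R : realType) (M : mfdData R) (p : M) :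
  charted M -> mdiffble (fun x : M => x) p.
Proof. by move=> hM; exact: is_mdiff_mdiffble (is_mdiff_id p hM). Qed.

Lemma mdiff_id (R : realType) (M : mfdData R) (p : M) v :
  charted M -> mdiff (fun x : M => x) p v = v.
Proof. by move=> hM; exact: is_mdiffE (is_mdiff_id p hM). Qed.

Lemma mdiffble_cst (R : realType) (M N : mfdData R) (p : M) (q : N) :
  mdiffble (fun _ : M => q) p.
Proof. exact: is_mdiff_mdiffble (is_mdiff_cst p q). Qed.

Lemma mdiff_cst (R : realType) (M N : mfdData R) (p : M) (q : N) v :
  mdiff (fun _ : M => q) p v = 0.
Proof. exact: is_mdiffE (is_mdiff_cst p q). Qed.

Lemma mdiffble_fst (R : realType) (M N : mfdData R) (p : prod_mfd M N) :
  charted M -> @mdiffble R (prod_mfd M N) M fst p.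
Proof. by move=> hM; exact: is_mdiff_mdiffble (is_mdiff_fst p hM). Qed.

Lemma mdiff_fst (R : realType) (M N : mfdData R) (p : prod_mfd M N) v :
  charted M -> @mdiff R (prod_mfd M N) M fst p v = lsubmx v.
Proof. by move=> hM; exact: is_mdiffE (is_mdiff_fst p hM). Qed.

Lemma mdiffble_snd (R : realType) (M N : mfdData R) (p : prod_mfd M N) :
  charted N -> @mdiffble R (prod_mfd M N) N snd p.
Proof. by move=> hN; exact: is_mdiff_mdiffble (is_mdiff_snd p hN). Qed.

Lemma mdiff_snd (R : realType) (M N : mfdData R) (p : prod_mfd M N) v :
  charted N -> @mdiff R (prod_mfd M N) N snd p v = rsubmx v.
Proof. by move=> hN; exact: is_mdiffE (is_mdiff_snd p hN). Qed.

Lemma msmooth_mdiffble (R : realType) (M N : mfdData R) (f : M -> N) (p : M) :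
  msmooth f -> mdiffble f p.
Proof. by move=> /(_ p); exact: msmooth_mdiff. Qed.

(** * Velocities of curves *)

Definition has_velocity (R : realType) (M : mfdData R) (c : R -> M) (t : R)
    (w : tangent M) : Prop :=
  {for t, continuous c} /\
  @is_diff_def R R^o (tangent M) _ (Phantom _ (nbhs t)) (chart (c t) \o c)
    (fun u => u *: w).

Lemma has_velocityE (R : realType) (M : mfdData R) (c : R -> M) t w :
  has_velocity c t w -> velocity c t = w.
Proof. by move=> [_ [cd cE]]; rewrite /velocity derive1E' // cE scale1r. Qed.

Lemma smooth_curve_velocity (R : realType) (M : mfdData R) (c : R -> M) t :
  smooth_curve c -> has_velocity c t (velocity c t).
Proof.
move=> [cc cs]; split; first exact: cc.
have [U [_ Ut] sU] := cs t; have [/(_ _ Ut) cd _] := sU 1%N.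
split => //; apply/funext => u; rewrite /velocity derive1E' //.
by rewrite -[in LHS](mulr1 u) -[u * 1]/(u *: (1 : R^o)) linearZ.
Qed.

Lemma has_velocity_cst (R : realType) (M : mfdData R) (p : M) t :
  has_velocity (fun _ : R => p) t 0.
Proof.
split; first exact: cvg_cst.
have -> : (fun u : R^o => u *: (0 : tangent M)) = (0 : R^o -> tangent M).
  by apply/funext => u; rewrite scaler0.
exact: is_diff_cst.
Qed.

Lemma has_velocity_comp (R : realType) (M N : mfdData R) (f : M -> N)
    (c : R -> M) t w : charted M ->
  has_velocity c t w -> mdiffble f (c t) ->
  has_velocity (fun s => f (c s)) t (mdiff f (c t) w).
Proof.
move=> hM [cc cd] [fc fd]; split; first exact: continuous_comp.
have := is_diff_chart_chain (F := chart (f (c t)) \o f) hM cc cd fd.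
by congr (is_diff_def _ _ _); apply/funext => u; rewrite /= /mdiff linearZ.
Qed.

Lemma velocity_comp (R : realType) (M N : mfdData R) (f : M -> N)
    (c : R -> M) t : charted M ->
  smooth_curve c -> mdiffble f (c t) ->
  velocity (fun s => f (c s)) t = mdiff f (c t) (velocity c t).
Proof.
move=> hM cs hf; apply: has_velocityE; apply: has_velocity_comp => //.
exact: smooth_curve_velocity.
Qed.

(** * Groups with differentiable multiplication *)

Local Notation "x ** y" := (lmul x y) (at level 40, left associativity).

(** The part of [is_lie_group] that the adjoint action relies on.  A semidirect
    product inherits it from its factors by the first-order chain rule, so the
    theory of [Ad] applies to it. *)
Definition diff_group (R : realType) (G : lieData R) : Prop :=
  [/\ charted G,
      [/\ associative (@lmul R G), left_id (lone G) (@lmul R G),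
          right_id (lone G) (@lmul R G),
          left_inverse (lone G) (@linv R G) (@lmul R G) &
          right_inverse (lone G) (@linv R G) (@lmul R G)] &
      forall x, @mdiffble R (prod_mfd G G) G (fun x => x.1 ** x.2) x].

Lemma lie_diff_group (R : realType) (G : lieData R) :
  is_lie_group G -> diff_group G.
Proof.
move=> [hG ax smul _]; split => //; first exact: manifold_charted.
by move=> x; exact: msmooth_mdiffble.
Qed.

Lemma mdiffble_mul (R : realType) (G : lieData R) (M : mfdData R)
    (f g : M -> G) (p : M) : charted M -> diff_group G ->
  mdiffble f p -> mdiffble g p -> mdiffble (fun x => f x ** g x) p.
Proof.
move=> hM [hG _ hmul] hf hg.
have hfg := mdiffble_pair hf hg.
exact: (mdiffble_comp hM (charted_prod hG hG) hfg (hmul _)).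
Qed.

Lemma mdiffble_mull (R : realType) (G : lieData R) (g x : G) :
  diff_group G -> mdiffble (fun y => g ** y) x.
Proof.
move=> hG; have [cG _ _] := hG; apply: mdiffble_mul => //.
  exact: mdiffble_cst.
exact: mdiffble_id.
Qed.

Lemma mdiffble_mulr (R : realType) (G : lieData R) (g x : G) :
  diff_group G -> mdiffble (fun y => y ** g) x.
Proof.
move=> hG; have [cG _ _] := hG; apply: mdiffble_mul => //.
  exact: mdiffble_id.
exact: mdiffble_cst.
Qed.

Lemma mdiffble_conj (R : realType) (G : lieData R) (g x : G) :
  diff_group G -> mdiffble (fun y => g ** y ** linv g) x.
Proof.
move=> hG; have [cG _ _] := hG; apply: mdiffble_mul => //.
  exact: mdiffble_mull.
exact: mdiffble_cst.
Qed.

Lemma lconj1 (R : realType) (G : lieData R) (g : G) :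
  diff_group G -> g ** lone G ** linv g = lone G.
Proof. by move=> [_ [_ _ mulr1 _ mulrV] _]; rewrite mulr1 mulrV. Qed.

Lemma lmul_inj (R : realType) (G : lieData R) (g x y : G) :
  diff_group G -> g ** x = g ** y -> x = y.
Proof.
move=> [_ [mA m1 _ mV _] _] gxy.
by rewrite -[x]m1 -[y]m1 -(mV g) -!mA gxy.
Qed.

Lemma linvM (R : realType) (G : lieData R) (x y : G) :
  diff_group G -> linv (x ** y) = linv y ** linv x.
Proof.
move=> hG; have [_ [mA m1 mr1 mV mVr] _] := hG.
apply: (lmul_inj (g := x ** y)) => //.
by rewrite mVr mA -(mA x) mVr mr1 mVr.
Qed.

Lemma linv1 (R : realType) (G : lieData R) :
  diff_group G -> linv (lone G) = lone G.
Proof. by move=> [_ [mA m1 mr1 mV mVr] _]; rewrite -[LHS]m1 mVr. Qed.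

(** Conjugation by x y is conjugation by y followed by conjugation by x, both
    of which fix the identity. *)
Lemma AdM (R : realType) (G : lieData R) (x y : G) (Z : lie_alg G) :
  diff_group G -> Ad (x ** y) Z = Ad x (Ad y Z).
Proof.
move=> hG; have [cG [mA _ _ _ _] _] := hG.
have <- : mdiff (fun z => x ** (y ** z ** linv y) ** linv x) (lone G) Z =
    Ad x (Ad y Z).
  apply: (mdiff_comp (g := fun z => y ** z ** linv y)
    (f := fun z => x ** z ** linv x)) => //; first exact: lconj1.
    exact: mdiffble_conj.
  exact: mdiffble_conj.
have -> : (fun z => x ** (y ** z ** linv y) ** linv x) =
    (fun z => x ** y ** z ** linv (x ** y)).
  apply/funext => z.
  rewrite (linvM x y hG).
  by rewrite !mA.
by [].
Qed.

Lemma Ad1 (R : realType) (G : lieData R) (Z : lie_alg G) :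
  diff_group G -> Ad (lone G) Z = Z.
Proof.
move=> hG; have [cG [mA m1 mr1 mV mVr] _] := hG.
rewrite /Ad; have -> : (fun z => lone G ** z ** linv (lone G)) = (fun z => z).
  by apply/funext => z; rewrite (linv1 hG) m1 mr1.
exact: mdiff_id.
Qed.

(** * The adjoint action of the semidirect product *)

Definition diff_action (R : realType) (G H : lieData R) (alpha : G -> H -> H) :
  Prop :=
  [/\ diff_group G, diff_group H,
      forall g, {morph alpha g : h h' / h ** h' >-> h ** h'},
      (forall h, alpha (lone G) h = h) /\
        (forall g g' h, alpha (g ** g') h = alpha g (alpha g' h)) &
      forall x, @mdiffble R (prod_mfd G H) H (fun x => alpha x.1 x.2) x].

Lemma crossed_diff_action (R : realType) (G H : lieData R)
    (alpha : G -> H -> H) (tau : H -> G) :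
  is_lie_crossed_module alpha tau -> diff_action alpha.
Proof.
move=> [[hG hH] _ [aM a1 aA asm] _ _].
split => //; try exact: lie_diff_group.
by move=> x; exact: msmooth_mdiffble.
Qed.

Lemma alpha_lone (R : realType) (G H : lieData R) (alpha : G -> H -> H)
    (g : G) : diff_action alpha -> alpha g (lone H) = lone H.
Proof.
move=> [_ hH aM _ _]; have [_ [mA m1 mr1 mV mVr] _] := hH.
apply: (lmul_inj (g := alpha g (lone H))) => //.
by rewrite -aM m1 mr1.
Qed.

Lemma alpha_linv (R : realType) (G H : lieData R) (alpha : G -> H -> H)
    (g : G) (h : H) : diff_action alpha -> alpha g (linv h) = linv (alpha g h).
Proof.
move=> ha; have [_ hH aM _ _] := ha; have [_ [mA m1 mr1 mV mVr] _] := hH.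
apply: (lmul_inj (g := alpha g h)) => //.
by rewrite -aM !mVr alpha_lone.
Qed.

Lemma mdiffble_alpha (R : realType) (G H : lieData R) (alpha : G -> H -> H)
    (M : mfdData R) (f : M -> G) (k : M -> H) (p : M) :
  charted M -> diff_action alpha -> mdiffble f p -> mdiffble k p ->
  mdiffble (fun x => alpha (f x) (k x)) p.
Proof.
move=> hM [[hG _ _] [hH _ _] _ _ ha] hf hk.
have hfk := mdiffble_pair hf hk.
exact: (mdiffble_comp hM (charted_prod hG hH) hfk (ha _)).
Qed.

Lemma mdiffble_alphag (R : realType) (G H : lieData R) (alpha : G -> H -> H)
    (g : G) (h : H) : diff_action alpha -> mdiffble (alpha g) h.
Proof.
move=> ha; have [_ [cH _ _] _ _ _] := ha.
apply: (mdiffble_alpha (f := fun=> g) (k := fun x => x)) => //.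
  exact: mdiffble_cst.
exact: mdiffble_id.
Qed.

Lemma semidirect_group (R : realType) (G H : lieData R) (alpha : G -> H -> H) :
  diff_action alpha -> diff_group (semidirect alpha).
Proof.
move=> ha; have [hG hH aM [a1 aA] _] := ha.
have [cG [mAG m1G mr1G mVG mVrG] _] := hG.
have [cH [mAH m1H mr1H mVH mVrH] _] := hH.
have cHG : charted (prod_mfd H G) by exact: charted_prod.
have cP : charted (prod_mfd (prod_mfd H G) (prod_mfd H G)).
  exact: charted_prod.
split; first exact: cHG.
  split.
  - by move=> [h1 g1] [h2 g2] [h3 g3] /=; rewrite aM aA !mAH mAG.
  - by move=> [h g] /=; rewrite a1 m1H m1G.
  - by move=> [h g] /=; rewrite (alpha_lone _ ha) mr1H mr1G.
  - by move=> [h g] /=; rewrite -aM mVH mVG (alpha_lone _ ha).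
  - by move=> [h g] /=; rewrite -aA mVrG a1 mVrH.
move=> x.
have d1 := @mdiffble_fst R (prod_mfd H G) (prod_mfd H G) x cHG.
have d2 := @mdiffble_snd R (prod_mfd H G) (prod_mfd H G) x cHG.
have d11 := mdiffble_comp cP cHG d1 (mdiffble_fst _ cH).
have d12 := mdiffble_comp cP cHG d1 (mdiffble_snd _ cG).
have d21 := mdiffble_comp cP cHG d2 (mdiffble_fst _ cH).
have d22 := mdiffble_comp cP cHG d2 (mdiffble_snd _ cG).
apply: mdiffble_pair.
  exact: (mdiffble_mul cP hH d11 (mdiffble_alpha cP ha d12 d21)).
exact: (mdiffble_mul cP hG d12 d22).
Qed.

(** Conjugation by (1, g) is the product map (y, x) |-> (alpha g y, g x g^-1). *)
Lemma Ad_sd_G (R : realType) (G H : lieData R) (alpha : G -> H -> H)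
    (g : G) (Y : lie_alg H) (Z : lie_alg G) :
  diff_action alpha ->
  Ad (sd_pair alpha (lone H) g) (sd_lie alpha Y Z) =
  sd_lie alpha (dalpha alpha g Y) (Ad g Z).
Proof.
move=> ha; have [hG hH aM [a1 aA] _] := ha.
have [cG [mAG m1G mr1G mVG mVrG] _] := hG.
have [cH [mAH m1H mr1H mVH mVrH] _] := hH.
have cHG : charted (prod_mfd H G) by exact: charted_prod.
have dH := @mdiffble_fst R H G (lone H, lone G) cH.
have dG := @mdiffble_snd R H G (lone H, lone G) cG.
rewrite /Ad; set f := (fun x => _).
have {f} -> : f = (fun x => (alpha g x.1, g ** x.2 ** linv g)).
  apply/funext => -[h x]; rewrite /f /= m1H.
  by rewrite (linv1 hH) !(alpha_lone _ ha) mr1H.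
have d1 := mdiffble_comp cHG cH dH (mdiffble_alphag g _ ha).
have d2 := mdiffble_comp cHG cG dG (mdiffble_conj g _ hG).
etransitivity; first exact: (mdiff_pair _ d1 d2).
congr row_mx.
  etransitivity.
    exact: (mdiff_comp _ cHG cH erefl dH (mdiffble_alphag g _ ha)).
  by rewrite mdiff_fst // /sd_lie row_mxKl.
etransitivity.
  exact: (mdiff_comp _ cHG cG erefl dG (mdiffble_conj g _ hG)).
by rewrite mdiff_snd // /sd_lie row_mxKr.
Qed.

(** The projection H x G -> G is a homomorphism that kills (h, 1), hence is
    invariant under conjugation by (h, 1). *)
Lemma rsubmx_Ad_sd_H (R : realType) (G H : lieData R) (alpha : G -> H -> H)
    (h : H) (V : lie_alg (semidirect alpha)) :
  diff_action alpha ->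
  rsubmx (Ad (sd_pair alpha h (lone G)) V : 'rV[R]_(Defs.dim H + Defs.dim G))
  = rsubmx (V : 'rV[R]_(Defs.dim H + Defs.dim G)).
Proof.
move=> ha; have [hG hH aM [a1 aA] _] := ha.
have [cG [mAG m1G mr1G mVG mVrG] _] := hG.
have [cH _ _] := hH.
have hS := semidirect_group ha; have [cS _ _] := hS.
have dG := @mdiffble_snd R H G (lone H, lone G) cG.
rewrite -(mdiff_snd (lone H, lone G) V cG).
rewrite -(mdiff_snd (lone H, lone G) (Ad _ V) cG).
set s := sd_pair alpha h (lone G).
have dC := @mdiffble_conj R (semidirect alpha) s (lone (semidirect alpha)) hS.
have E := @mdiff_comp R (semidirect alpha) (semidirect alpha) G _ _
  (fun x => s ** x ** linv s) snd V cS cS (lconj1 s hS) dC dG.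
rewrite /Ad; etransitivity; first by symmetry; exact: E.
have -> : (fun x : semidirect alpha => (s ** x ** linv s).2) = snd.
  by apply/funext => -[y x] /=; rewrite m1G (linv1 hG) mr1G.
by [].
Qed.

(** The inclusion y |-> (y, 1) of H intertwines conjugation by h with
    conjugation by (h, 1). *)
Lemma Ad_sd_H (R : realType) (G H : lieData R) (alpha : G -> H -> H)
    (h : H) (W : lie_alg H) :
  diff_action alpha ->
  Ad (sd_pair alpha h (lone G)) (sd_lie alpha W 0) =
  sd_lie alpha (Ad h W) 0.
Proof.
move=> ha; have [hG hH aM [a1 aA] _] := ha.
have [cG [mAG m1G mr1G mVG mVrG] _] := hG.
have [cH [mAH m1H mr1H mVH mVrH] _] := hH.
have hS := semidirect_group ha; have [cS _ _] := hS.
set s := sd_pair alpha h (lone G).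
have dC := @mdiffble_conj R (semidirect alpha) s (lone (semidirect alpha)) hS.
have inH (k : H -> H) (X : lie_alg H) : mdiffble k (lone H) ->
    @mdiff R H (prod_mfd H G) (fun y => (k y, lone G)) (lone H) X =
    sd_lie alpha (mdiff k (lone H) X) 0.
  move=> dk; rewrite (mdiff_pair X dk (mdiffble_cst _ _)).
  by rewrite mdiff_cst.
have dI : @mdiffble R H (prod_mfd H G) (fun y => (y, lone G)) (lone H).
  exact: (mdiffble_pair (mdiffble_id _ cH) (mdiffble_cst _ _)).
rewrite /Ad -(inH _ _ (mdiffble_conj h _ hH)).
rewrite -{1}(mdiff_id (lone H) W cH) -(inH _ _ (mdiffble_id _ cH)).
have E := @mdiff_comp R H (semidirect alpha) (semidirect alpha) (lone H) _
  (fun y => sd_pair alpha y (lone G)) (fun x => s ** x ** linv s) W cH cS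
  (erefl (lone (semidirect alpha))) dI dC.
etransitivity; first by symmetry; exact: E.
have -> // : (fun y : H => s ** (sd_pair alpha y (lone G)) ** linv s) =
   (fun y => (h ** y ** linv h, lone G)).
by apply/funext => y /=; rewrite /= !mr1G (linv1 hG) mr1G !a1.
Qed.


(** * Vertical vectors *)

(** Existence of the exponential map is avoided: if no one-parameter subgroup
    has velocity [Z], then [expu Z] is the constant curve at the identity, for
    which the conclusion holds as well. *)
Lemma expu_lone_velocity (R : realType) (G : lieData R) (Z : lie_alg G) :
  diff_group G ->
  expu Z 0 = lone G /\ exists w, has_velocity (expu Z) 0 w.
Proof.
move=> hG; have [_ [mA m1 mr1 mV mVr] _] := hG.
rewrite /expu; case: xgetP => [c _ [cs cM _]|_]; last first.
  by split=> //; exists 0; exact: has_velocity_cst.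
(* A homomorphism from the additive reals maps 0 to the identity. *)
split; last by exists (velocity c 0); exact: smooth_curve_velocity.
apply: (lmul_inj (g := c 0)) => //.
by rewrite mr1 -cM addr0.
Qed.

(** The projection of u |-> p exp(uZ) to the base is constant. *)
Lemma fund_vertical (R : realType) (G : lieData R) (P M : mfdData R)
    (pi : P -> M) (act : P -> G -> P) (p : P) (Z : lie_alg G) :
  is_principal_bundle pi act -> vertical pi p (fund act p Z).
Proof.
move=> [[hG hP hM] pis [acts act1 actA pact] _].
have dG := lie_diff_group hG; have [cG _ _] := dG.
have cP := manifold_charted hP.
have [e0 [w hw]] := expu_lone_velocity Z dG.
have dact : mdiffble (act p) (expu Z 0).
  apply: (mdiffble_comp (g := fun x => (p, x) : prod_mfd P G)
    (f := fun x => act x.1 x.2) cG (charted_prod cP cG)).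
    exact: (mdiffble_pair (mdiffble_cst _ _) (mdiffble_id _ cG)).
  exact: msmooth_mdiffble.
have h1 := has_velocity_comp cG hw dact.
have h2 := has_velocity_comp cP h1 (msmooth_mdiffble _ pis).
rewrite /vertical /fund (has_velocityE h1).
have := has_velocityE h2; rewrite {1}e0 act1 => <-.
have -> : (fun s => pi (act p (expu Z s))) = (fun=> pi p).
  by apply/funext => s; exact: pact.
exact: has_velocityE (has_velocity_cst _ _).
Qed.

(** * Integrals of row vectors *)

Lemma vint0 (R : realType) (n : nat) (t0 t1 : R) (f : R -> 'rV[R]_n) :
  (forall t, f t = 0) -> vint t0 t1 f = 0.
Proof.
move=> f0; apply/rowP => i; rewrite !mxE.
under eq_Rintegral do rewrite f0 mxE.
by rewrite Rintegral_cst // mul0r.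
Qed.

Lemma integrable_continuous (R : realType) (t0 t1 : R) (f : R -> R) :
  continuous f -> (@lebesgue_measure R).-integrable `[t0, t1] (EFin \o f).
Proof.
move=> fc; apply: continuous_compact_integrable; first exact: segment_compact.
exact: continuous_subspaceT.
Qed.

Lemma Rintegral_sum (R : realType) (t0 t1 : R) (I : Type) (r : seq I)
    (g : I -> R -> R) : (forall i, continuous (g i)) ->
  \int[lebesgue_measure]_(t in `[t0, t1]) (\sum_(i <- r) g i t) =
  \sum_(i <- r) \int[lebesgue_measure]_(t in `[t0, t1]) g i t.
Proof.
move=> gc; elim: r => [|i r IH].
  under eq_Rintegral do rewrite big_nil.
  by rewrite Rintegral_cst // mul0r big_nil.
under eq_Rintegral do rewrite big_cons.
rewrite big_cons -IH RintegralD //; first exact: integrable_continuous.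
apply: integrable_continuous => t.
by apply: cvg_big => [|j _]; [exact: add_continuous|exact: gc].
Qed.

Lemma linear_row_sum (R : realType) (n : nat) (L : normedModType R)
    (f : 'rV[R]_n -> L) (u : 'rV[R]_n) : linear f ->
  f u = \sum_(j < n) u ord0 j *: f (delta_mx 0 j).
Proof.
move=> lf.
pose F : {linear _ -> _} := HB.pack f (GRing.isLinear.Build _ _ _ _ f lf).
rewrite -[f]/(F : _ -> _) {1}(row_sum_delta u) linear_sum.
by apply: eq_bigr => j _; rewrite linearZ.
Qed.

(** Continuity provides the integrability of the components, without which the
    integral is not additive. *)
Lemma vint_linear (R : realType) (m n : nat) (t0 t1 : R)
    (f : R -> 'rV[R]_m) (L : 'rV[R]_m -> 'rV[R]_n) : linear L ->
  continuous f -> vint t0 t1 (fun t => L (f t)) = L (vint t0 t1 f).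
Proof.
move=> Llin fc; apply/rowP => i; rewrite mxE.
have fjc j : continuous (fun t => f t ord0 j).
  move=> t; apply: (@continuous_comp _ _ _ f (fun u : 'rV[R]_m => u ord0 j)).
    exact: fc.
  exact: coord_continuous.
have Lsum (u : 'rV[R]_m) :
    L u ord0 i = \sum_j u ord0 j * L (delta_mx 0 j) ord0 i.
  rewrite (linear_row_sum u Llin) summxE.
  by apply: eq_bigr => j _; rewrite mxE.
rewrite Lsum; under eq_Rintegral do rewrite Lsum.
rewrite Rintegral_sum => [|j t]; last first.
  by apply: cvgM; [exact: fjc|exact: cvg_cst].
apply: eq_bigr => j _; rewrite mxE RintegralZr //.
exact: integrable_continuous.
Qed.

(** * Continuity of a 2-form along a path *)

(** The two linear maps are the derivatives of mutually inverse transition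
    maps. *)
Lemma tframe_tcoord (R : realType) (M : mfdData R) (p q : M) (w : tangent M) :
  is_manifold M -> chart_dom p q -> tframe p (chart p q) (tcoord p q w) = w.
Proof.
move=> hM pq; have cM := manifold_charted hM.
have [_ _ charts trans] := hM.
have [_ op _ inv_p _] := charts p; have [qq _ _ _ _] := charts q.
have [_ near_q _ ic] := cM q; have qK := chart_invK q cM.
have pqK : chart_inv p (chart p q) = q by apply: inv_p; rewrite inE.
rewrite /tframe /tcoord pqK.
have d1 : differentiable (chart p \o chart_inv q) (chart q q).
  by have [d _] := trans q p 1%N; apply: d; exists q.
have d2 : differentiable (chart q \o chart_inv p)
    ((chart p \o chart_inv q) (chart q q)).
  have [d _] := trans p q 1%N.
  by apply: d; exists q; rewrite /= ?qK.
have := diff_comp d1 d2; rewrite /= qK => /(congr1 (fun k => k w)) /= <-.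
have near_dom : \forall y \near chart q q, chart_dom p (chart_inv q y).
  apply: ic; rewrite qK; apply: open_nbhs_nbhs; by split.
have did : is_diff (chart q q)
    ((chart q \o chart_inv p) \o (chart p \o chart_inv q)) id.
  apply: (@near_eq_is_diff _ _ _ _ id).
  near=> y; rewrite /= inv_p.
    by rewrite (near near_q y).
  by rewrite inE; near: y.
by rewrite (@diff_val _ _ _ _ _ _ _ did).
Unshelve. all: by end_near. Qed.

Lemma tcoord_velocity (R : realType) (M : mfdData R) (p : M) (c : R -> M)
    (s : R) : is_manifold M -> smooth_curve c -> chart_dom p (c s) ->
  tcoord p (c s) (velocity c s) = derive1 (chart p \o c) s.
Proof.
move=> hM cs pcs; have cM := manifold_charted hM.
have [cc cd] := smooth_curve_velocity s cs.
have [_ _ charts trans] := hM; have [qq _ _ _ _] := charts (c s).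
have d1 : is_diff (chart (c s) (c s)) (chart p \o chart_inv (c s))
    ('d (chart p \o chart_inv (c s)) (chart (c s) (c s))).
  by split=> //; have [d _] := trans (c s) p 1%N; apply: d; exists (c s).
have [d E] := is_diff_chart_chain cM cc cd d1.
by rewrite derive1E' // E /= scale1r.
Qed.

Lemma form2_frame (R : realType) (P : mfdData R) (L : normedModType R)
    (Theta : P -> tangent P -> tangent P -> L) (p : P) x
    (a b : 'rV[R]_(Defs.dim P)) : is_form2 Theta ->
  Theta (chart_inv p x) (tframe p x a) (tframe p x b) =
  \sum_i \sum_j (a ord0 i * b ord0 j) *:
    Theta (chart_inv p x) (tframe p x (delta_mx 0 i)) (tframe p x (delta_mx 0 j)).
Proof.
move=> [lin1 lin2 _ _].
rewrite (@linear_row_sum R _ L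
  (fun a => Theta (chart_inv p x) (tframe p x a) (tframe p x b)) a); last first.
  by move=> k u v; rewrite /tframe linearP lin2.
apply: eq_bigr => i _.
rewrite (@linear_row_sum R _ L
  (fun b => Theta (chart_inv p x) _ (tframe p x b)) b); last first.
  by move=> k u v; rewrite /tframe linearP lin1.
by rewrite scaler_sumr; apply: eq_bigr => j _; rewrite scalerA.
Qed.

Lemma smooth_at_continuous (R : realType) (V W : normedModType R)
    (f : V -> W) (x : V) : smooth_at f x -> {for x, continuous f}.
Proof. by move=> [U [_ Ux] /(_ 0%N) /= ]; apply. Qed.

Lemma smooth_at_derive_continuous (R : realType) (V W : normedModType R)
    (f : V -> W) (x v : V) :
  smooth_at f x -> {for x, continuous (fun y => 'D_v f y)}.
Proof. by move=> [U [_ Ux] /(_ 1%N) [_ /(_ v)]]; apply. Qed.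

(** Near [t] every vector can be written in the frame of the one chart
    around [c t]; the coordinates of [v] and of the velocity, and the components
    of the form, are then continuous functions of the parameter. *)
Lemma form2_along_continuous (R : realType) (P : mfdData R)
    (L : normedModType R) (Theta : P -> tangent P -> tangent P -> L)
    (c : R -> P) (v : R -> tangent P) :
  is_manifold P -> is_form2 Theta -> smooth_curve c ->
  smooth_field_along c v ->
  continuous (fun t => Theta (c t) (v t) (velocity c t)).
Proof.
move=> hP hT hc hv t; set p := c t.
have [ccont csm] := hc.
have [_ _ charts _] := hP; have [pp op _ inv_p [cc _]] := charts p.
pose a s := tcoord p (c s) (v s).
pose b s : 'rV[R]_(Defs.dim P) := derive1 (chart p \o c) s.
pose B s := \sum_i \sum_j (a s ord0 i * b s ord0 j) *:
  Theta (chart_inv p (chart p (c s)))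
    (tframe p (chart p (c s)) (delta_mx 0 i))
    (tframe p (chart p (c s)) (delta_mx 0 j)).
have near_dom : \forall s \near t, chart_dom p (c s).
  by apply: ccont; apply: open_nbhs_nbhs; split.
have near_B : \forall s \near t, B s = Theta (c s) (v s) (velocity c s).
  near=> s; have ps : chart_dom p (c s) by near: s.
  rewrite /B -form2_frame // /a /b -tcoord_velocity // !tframe_tcoord //.
  by rewrite inv_p // inE.
have ac : {for t, continuous a} := smooth_at_continuous (hv t).
have bc : {for t, continuous b}.
  have := smooth_at_derive_continuous (v := (1 : R^o)) (csm t).
  by rewrite (_ : (fun _ => _) = b) //; apply/funext => s; rewrite /b derive1E.
have pc : {for t, continuous (chart p \o c)}.
  by apply: continuous_comp; [exact: ccont|exact: cc].
rewrite /continuous_at -(nbhs_singleton near_B).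
apply: cvg_trans; first exact: near_eq_cvg near_B.
apply: cvg_big => [|i _]; first exact: add_continuous.
apply: cvg_big => [|j _]; first exact: add_continuous.
apply: cvgZ.
  apply: cvgM.
    exact: (cvg_comp _ _ ac (@coord_continuous R 1 _ ord0 i (a t))).
  exact: (cvg_comp _ _ bc (@coord_continuous R 1 _ ord0 j (b t))).
have [_ _ _ /(_ p (delta_mx 0 i) (delta_mx 0 j)) sT] := hT.
exact: (continuous_comp pc (smooth_at_continuous sT)).
Unshelve. all: by end_near. Qed.

(** * Equivariance *)

Lemma mdiff_is_linear (R : realType) (M N : mfdData R) (f : M -> N) (p : M) :
  linear (mdiff f p).
Proof. by move=> k u v; rewrite /mdiff linearP. Qed.

Lemma mdiffble_act (R : realType) (G : lieData R) (P M : mfdData R)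
    (pi : P -> M) (act : P -> G -> P) (g : G) (p : P) :
  is_principal_bundle pi act -> mdiffble (act^~ g) p.
Proof.
move=> [[[hG _ _ _] hP _] _ [acts _ _ _] _].
have cG := manifold_charted hG; have cP := manifold_charted hP.
apply: (mdiffble_comp (g := fun x => (x, g) : prod_mfd P G)
  (f := fun x => act x.1 x.2) cP (charted_prod cP cG)).
  exact: (mdiffble_pair (mdiffble_id _ cP) (mdiffble_cst _ _)).
exact: msmooth_mdiffble.
Qed.

Lemma vint_equivariant (R : realType) (G : lieData R) (P M : mfdData R)
    (pi : P -> M) (act : P -> G -> P) (n : nat)
    (rho : G -> 'rV[R]_n -> 'rV[R]_n)
    (B : P -> tangent P -> tangent P -> 'rV[R]_n)
    (t0 t1 : R) (c : R -> P) (v : R -> tangent P) (g : G) :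
  is_principal_bundle pi act -> linear (rho (linv g)) ->
  is_form2 B -> equivariant2 act rho B ->
  smooth_curve c -> smooth_field_along c v ->
  vint t0 t1 (fun t => B (act (c t) g) (tact act (c t) (v t) g)
    (velocity (fun s => act (c s) g) t)) =
  rho (linv g) (vint t0 t1 (fun t => B (c t) (v t) (velocity c t))).
Proof.
move=> hpi lrho hB eB hc hv; have [[_ hP _] _ _ _] := hpi.
rewrite -vint_linear //; last exact: form2_along_continuous.
congr vint; apply/funext => t; rewrite -eB.
congr (B _ _ _); apply: (velocity_comp (f := act^~ g)) => //.
  exact: manifold_charted.
exact: mdiffble_act hpi.
Qed.

Lemma omega_equivariant (R : realType) (G : lieData R) (P M : mfdData R)
    (pi : P -> M) (act : P -> G -> P)
    (A : P -> tangent P -> lie_alg G)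
    (B0 : P -> tangent P -> tangent P -> lie_alg G)
    (C0L C0R : P -> tangent P -> lie_alg G)
    (t0 t1 : R) (c : R -> P) (v : R -> tangent P) (g : G) :
  is_principal_bundle pi act -> equivariant1 act (@Ad R G) A ->
  is_form2 B0 -> equivariant2 act (@Ad R G) B0 ->
  equivariant1 act (@Ad R G) C0L -> equivariant1 act (@Ad R G) C0R ->
  smooth_curve c -> smooth_field_along c v ->
  omega A B0 C0L C0R t0 t1 (fun t => act (c t) g)
    (fun t => tact act (c t) (v t) g) =
  Ad (linv g) (omega A B0 C0L C0R t0 t1 c v).
Proof.
move=> hpi eA hB eB eL eR hc hv.
have lAd : linear (@Ad R G (linv g)) by exact: mdiff_is_linear.
rewrite /omega eA eL eR (vint_equivariant t0 t1 hpi lAd hB eB hc hv).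
rewrite (GRing.semilinear_linear lAd).2 (GRing.zmod_morphism_linear lAd).
by rewrite (GRing.semilinear_linear lAd).2.
Qed.

(** Both sides are the derivative at [h] of
    y |-> alpha g (y h1) (alpha g (h h1))^-1 = alpha g (y h^-1). *)
Lemma translate_alpha (R : realType) (G H : lieData R) (alpha : G -> H -> H)
    (g : G) (h h1 : H) (X : tangent H) : diff_action alpha ->
  mdiff (fun y => y ** linv (alpha g (h ** h1))) (alpha g (h ** h1))
    (mdiff (alpha g) (h ** h1) (mdiff (fun y => y ** h1) h X)) =
  dalpha alpha g (mdiff (fun y => y ** linv h) h X).
Proof.
move=> ha; have [_ hH aM _ _] := ha.
have [cH [mA m1 mr1 mV mVr] _] := hH.
have dr k x := mdiffble_mulr k x hH.
have da x := mdiffble_alphag g x ha.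
have E1 := @mdiff_comp R H H H h _ (fun y => y ** h1) (alpha g) X cH cH
  erefl (dr h1 h) (da _).
have dar := mdiffble_comp cH cH (dr h1 h) (da _).
set k := linv (alpha g (h ** h1)).
have E2 := @mdiff_comp R H H H h _ (fun y => alpha g (y ** h1))
  (fun y => y ** k) X cH cH erefl dar (dr k _).
have E3 := @mdiff_comp R H H H h _ (fun y => y ** linv h) (alpha g) X cH cH
  (mVr h) (dr (linv h) h) (da _).
rewrite /dalpha -E3 -E1 -E2.
have -> // : (fun y => alpha g (y ** h1) ** k) =
  (fun y => alpha g (y ** linv h)).
apply/funext => y.
rewrite /k -(alpha_linv _ _ ha) -aM (linvM _ _ hH) !mA.
by rewrite -(mA y) mVr mr1.
Qed.

Lemma Omega_equivariant (R : realType)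
  (G H : lieData R) (alpha : G -> H -> H)
  (P M : mfdData R) (pi : P -> M) (act : P -> G -> P)
  (A : P -> tangent P -> lie_alg G)
  (B0 : P -> tangent P -> tangent P -> lie_alg G)
  (B1 : P -> tangent P -> tangent P -> lie_alg H)
  (C0L C0R : P -> tangent P -> lie_alg G)
  (C1L C1R : P -> tangent P -> lie_alg H)
  (t0 t1 : R) (c : R -> P) (v : R -> tangent P)
  (h h1 : H) (g1 : G) (X : tangent H) :
  diff_action alpha -> is_principal_bundle pi act ->
  equivariant1 act (@Ad R G) A ->
  is_form2 B0 -> equivariant2 act (@Ad R G) B0 ->
  is_form2 B1 -> equivariant2 act (dalpha alpha) B1 ->
  equivariant1 act (@Ad R G) C0L -> equivariant1 act (@Ad R G) C0R ->
  equivariant1 act (dalpha alpha) C1L -> equivariant1 act (dalpha alpha) C1R ->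
  smooth_curve c -> smooth_field_along c v ->
  Omega alpha A B0 B1 C0L C0R C1L C1R t0 t1
    (dec_act alpha act (c, h) h1 g1)
    (dec_tact alpha act (c, h) h1 g1 (v, X)) =
  Ad (linv (sd_pair alpha h1 g1))
    (Omega alpha A B0 B1 C0L C0R C1L C1R t0 t1 (c, h) (v, X)).
Proof.
move=> ha hpi eA hB0 eB0 hB1 eB1 eL0 eR0 eL1 eR1 hc hv.
have [hG hH aM [a1 aA] _] := ha.
have [cG [mAG m1G mr1G mVG mVrG] _] := hG.
have [cH [mAH m1H mr1H mVH mVrH] _] := hH.
have hS := semidirect_group ha.
have lal : linear (dalpha alpha (linv g1)) by exact: mdiff_is_linear.
rewrite /Omega /dec_act /dec_tact; cbn [fst snd].
rewrite (omega_equivariant t0 t1 g1 hpi eA hB0 eB0 eL0 eR0 hc hv).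
rewrite eL1 eR1 (vint_equivariant t0 t1 hpi lal hB1 eB1 hc hv).
rewrite (translate_alpha _ _ _ _ ha).
rewrite -(GRing.zmod_morphism_linear lal) -!(GRing.semilinear_linear lal).2.
rewrite -(Ad_sd_G _ _ _ ha).
rewrite -!(AdM _ _ _ hS).
(* The adjoint operators on both sides belong to the same group element. *)
have -> // : sd_pair alpha (linv (alpha (linv g1) (h ** h1))) (lone G) **
    sd_pair alpha (lone H) (linv g1) =
  linv (sd_pair alpha h1 g1) ** sd_pair alpha (linv h) (lone G).
rewrite /sd_pair /= a1 mr1H m1G mr1G -(alpha_linv _ _ ha) -aM.
by rewrite (linvM _ _ hH).
Qed.

(** * Orbit directions *)

Lemma omega_vertical (R : realType) (G : lieData R) (P M : mfdData R)
    (pi : P -> M) (act : P -> G -> P)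
    (A : P -> tangent P -> lie_alg G)
    (B0 : P -> tangent P -> tangent P -> lie_alg G)
    (C0L C0R : P -> tangent P -> lie_alg G)
    (t0 t1 : R) (c : R -> P) (Z : lie_alg G) :
  is_principal_bundle pi act -> (forall p Y, A p (fund act p Y) = Y) ->
  horizontal2 pi B0 -> horizontal1 pi C0L -> horizontal1 pi C0R ->
  omega A B0 C0L C0R t0 t1 c (fun t => fund act (c t) Z) = Z.
Proof.
move=> hpi AZ hB hL hR; have ver p := fund_vertical p Z hpi.
rewrite /omega AZ hL // hR // addr0 subr0 vint0 ?addr0 // => t.
by apply: hB; left.
Qed.

Lemma right_translate_left (R : realType) (H : lieData R) (h : H)
    (W : lie_alg H) : diff_group H ->
  mdiff (fun y => y ** linv h) h (mdiff (fun y => h ** y) (lone H) W) = Ad h W.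
Proof.
move=> hH; have [cH [_ _ mr1 _ _] _] := hH.
symmetry.
exact: (@mdiff_comp R H H H (lone H) h (fun y => h ** y)
  (fun y => y ** linv h) W cH cH (mr1 h) (mdiffble_mull h _ hH)
  (mdiffble_mulr (linv h) _ hH)).
Qed.

(** If [V] is Ad(h^-1) applied to (0, Z), this says that Y + (1 - Ad(h^-1)) Z,
    which lies in L(H), and Ad(h^-1) Z add up to Y + Z. *)
Lemma row_mx_complement (R : realType) (m n : nat) (Y : 'rV[R]_m)
    (Z : 'rV[R]_n) (V : 'rV[R]_(m + n)) : rsubmx V = Z ->
  row_mx (Y + lsubmx (row_mx 0 Z - V)) 0 + V = row_mx Y Z.
Proof.
move=> VZ; rewrite raddfB /= row_mxKl sub0r -{2}(hsubmxK V) VZ.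
by rewrite add_row_mx add0r addrNK.
Qed.

Lemma Omega_orbit (R : realType)
  (G H : lieData R) (alpha : G -> H -> H)
  (P M : mfdData R) (pi : P -> M) (act : P -> G -> P)
  (A : P -> tangent P -> lie_alg G)
  (B0 : P -> tangent P -> tangent P -> lie_alg G)
  (B1 : P -> tangent P -> tangent P -> lie_alg H)
  (C0L C0R : P -> tangent P -> lie_alg G)
  (C1L C1R : P -> tangent P -> lie_alg H)
  (t0 t1 : R) (c : R -> P) (h : H) (Y1 : lie_alg H) (Z1 : lie_alg G) :
  diff_action alpha -> is_principal_bundle pi act ->
  (forall p Y, A p (fund act p Y) = Y) ->
  horizontal2 pi B0 -> horizontal2 pi B1 ->
  horizontal1 pi C0L -> horizontal1 pi C0R ->
  horizontal1 pi C1L -> horizontal1 pi C1R ->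
  Omega alpha A B0 B1 C0L C0R C1L C1R t0 t1 (c, h)
    (dec_orbit alpha act (c, h) Y1 Z1) = sd_lie alpha Y1 Z1.
Proof.
move=> ha hpi AZ hB0 hB1 hL0 hR0 hL1 hR1.
have [hG hH aM [a1 aA] _] := ha.
have [cG [mAG m1G mr1G mVG mVrG] _] := hG.
have [cH [mAH m1H mr1H mVH mVrH] _] := hH.
have hS := semidirect_group ha.
have ver p := fund_vertical p Z1 hpi.
rewrite /Omega /dec_orbit; cbn [fst snd].
rewrite (omega_vertical t0 t1 c Z1 hpi AZ hB0 hL0 hR0).
rewrite hL1 // hR1 // subr0 add0r vint0 ?add0r; last first.
  by move=> t; apply: hB1; left.
rewrite (right_translate_left _ _ hH).
set Zsd := sd_lie alpha 0 Z1.
set AZsd := Ad (sd_pair alpha (linv h) (lone G)) Zsd.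
set V := Y1 + _.
(* Written this way, the first summand is cancelled by Ad(h^-1). *)
have -> : sd_lie alpha (Ad h V) Z1 =
    Ad (sd_pair alpha h (lone G)) (sd_lie alpha V 0) + Zsd.
  by rewrite (Ad_sd_H _ _ ha) /Zsd /sd_lie add_row_mx addr0 add0r.
have lAd : linear (@Ad R (semidirect alpha) (sd_pair alpha (linv h) (lone G))).
  exact: mdiff_is_linear.
rewrite (GRing.semilinear_linear lAd).2 -(AdM _ _ _ hS) -/AZsd.
have -> : sd_pair alpha (linv h) (lone G) ** sd_pair alpha h (lone G) =
    lone (semidirect alpha).
  by rewrite /sd_pair /= a1 mVH m1G.
rewrite (Ad1 _ hS) /V.
have AZsdr : rsubmx (AZsd : 'rV[R]_(Defs.dim H + Defs.dim G)) = Z1.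
  by rewrite (rsubmx_Ad_sd_H _ _ ha) /Zsd /sd_lie row_mxKr.
exact: row_mx_complement AZsdr.
Qed.

Theorem proposition5p1 (R : realType)
  (G H : lieData R) (alpha : G -> H -> H) (tau : H -> G)
  (P M : mfdData R) (pi : P -> M) (act : P -> G -> P)
  (Abar A : P -> tangent P -> lie_alg G)
  (B0 : P -> tangent P -> tangent P -> lie_alg G)
  (B1 : P -> tangent P -> tangent P -> lie_alg H)
  (C0L C0R : P -> tangent P -> lie_alg G)
  (C1L C1R : P -> tangent P -> lie_alg H)
  (crossed : is_lie_crossed_module alpha tau)
  (bundle : is_principal_bundle pi act)
  (hAbar : is_connection act Abar)
  (hA : is_connection act A)
  (hB0 : eqhor_form2 pi act (@Ad R G) B0)
  (hB1 : eqhor_form2 pi act (dalpha alpha) B1)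
  (hC0L : eqhor_form1 pi act (@Ad R G) C0L)
  (hC0R : eqhor_form1 pi act (@Ad R G) C0R)
  (hC1L : eqhor_form1 pi act (dalpha alpha) C1L)
  (hC1R : eqhor_form1 pi act (dalpha alpha) C1R) :
  (forall (t0 t1 : R) (c : R -> P) (v : R -> tangent P)
      (h h1 : H) (g1 : G) (X : tangent H),
    is_hor_path Abar t0 t1 c ->
    is_path_tangent Abar t0 t1 c v ->
    Omega alpha A B0 B1 C0L C0R C1L C1R t0 t1
      (dec_act alpha act (c, h) h1 g1)
      (dec_tact alpha act (c, h) h1 g1 (v, X)) =
    Ad (linv (sd_pair alpha h1 g1))
      (Omega alpha A B0 B1 C0L C0R C1L C1R t0 t1 (c, h) (v, X))) /\
  (forall (t0 t1 : R) (c : R -> P) (h : H)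
      (Y1 : lie_alg H) (Z1 : lie_alg G),
    is_hor_path Abar t0 t1 c ->
    Omega alpha A B0 B1 C0L C0R C1L C1R t0 t1 (c, h)
      (dec_orbit alpha act (c, h) Y1 Z1) =
    sd_lie alpha Y1 Z1).
Proof.
have ha := crossed_diff_action crossed.
have [_ eA AZ] := hA.
have [fB0 eB0 zB0] := hB0; have [fB1 eB1 zB1] := hB1.
have [_ eL0 zL0] := hC0L; have [_ eR0 zR0] := hC0R.
have [_ eL1 zL1] := hC1L; have [_ eR1 zR1] := hC1R.
split.
  move=> t0 t1 c v h h1 g1 X [[_ hc _] _] [hv _ _].
  exact: (Omega_equivariant t0 t1 h h1 g1 X ha bundle).
by move=> t0 t1 c h Y1 Z1 _; exact: (Omega_orbit t0 t1 c h Y1 Z1 ha bundle).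
Qed.
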